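(* There exist a real number $\epsilon>0$ and a strictly increasing sequence $(n_k)_{k=1,2,\ldots}$ of positive integers such that for every estimator $(\hat M_n)_{n\ge 1}$ there exists a probability distribution $p^\star$ on $\mathbb{N}_+$ such that for all $k\ge 1$: $$\mathbf{P}_{p^\star}\left\{\left|\frac{\hat M_{n_k}(X_1,\ldots,X_{n_k})}{M_{n_k}(X_1,\ldots,X_{n_k})}-1\right|>\epsilon\right\}>\epsilon .$$ In particular, it is impossible to perform distribution-free PAC-learning of the missing mass in relative error, i.e. no estimator PAC-learns the missing mass in relative error with respect to the family of all probability distributions on $\mathbb{N}_+$.
   Context: $\mathbb{N}_+=\{1,2,3,\ldots\}$. For a probability distribution $p$ on $\mathbb{N}_+$, $\mathbf{P}_p$ denotes probability when $X_1,X_2,\ldots$ are i.i.d. with distribution $p$. The missing mass is $$M_n=M_n(X_1,\ldots,X_n)=\sum_{x\in\mathbb{N}_+}p(x)\,\mathbf{1}\{x\notin\{X_1,\ldots,X_n\}\}$$ (it depends on both the sample and $p$). An estimator is a sequence of functions $\hat M_n:\mathbb{N}_+^n\to[0,1]$, $n\ge1$ (not depending on $p$). An estimator PAC-learns the missing mass in relative error with respect to a family $\mathcal{P}$ of distributions on $\mathbb{N}_+$ if for every $p\in\mathcal{P}$ and every $\epsilon,\delta>0$ there exists $n_0(p,\epsilon,\delta)$ such that for all $n>n_0(p,\epsilon,\delta)$: $$\mathbf{P}_p\left\{\left|\frac{\hat M_n(X_1,\ldots,X_n)}{M_n(X_1,\ldots,X_n)}-1\right|<\epsilon\right\}>1-\delta.$$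 The learning is distribution-free if $\mathcal{P}$ consists of all distributions on $\mathbb{N}_+$. *)

(* Defs.v *)
From HB Require Import structures.
From mathcomp Require Import all_boot all_order all_algebra.
From mathcomp Require Import all_classical all_reals all_analysis.

Set Implicit Arguments.
Unset Strict Implicit.
Unset Printing Implicit Defensive.

Import Order.TTheory GRing.Theory Num.Theory.
Import numFieldNormedType.Exports.

Local Open Scope classical_set_scope.
Local Open Scope ring_scope.

Definition Nplus : Type := {n : nat | (0 < n)%N}.

HB.instance Definition _ := Countable.on Nplus.

HB.instance Definition _ := isPointed.Build Nplus (exist _ 1%N isT).

HB.instance Definition _ := @isMeasurable.Build default_measure_display
  Nplus discrete_measurable discrete_measurable0
  discrete_measurableC discrete_measurableU.

Section iid_sample.
Context {d : measure_display} {T : measurableType d}.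

Definition tuple_cons (n : nat) (x : T * n.-tuple T) : n.+1.-tuple T :=
  [tuple of x.1 :: x.2].

Lemma measurable_tuple_cons (n : nat) :
  measurable_fun [set: T * n.-tuple T] (@tuple_cons n).
Proof. exact: measurable_cons. Qed.

HB.instance Definition _ (n : nat) :=
  isMeasurableFun.Build _ _ _ _ (@tuple_cons n) (@measurable_tuple_cons n).

(* Joint law of n independent draws from p: the n-fold product measure,
   carried to n-tuples. *)
Fixpoint iid_law (R : realType) (p : probability T R) (n : nat) :
    probability (n.-tuple T) R :=
  match n return probability (n.-tuple T) R with
  | 0 => dirac [tuple]
  | m.+1 => distribution (p \x iid_law p m)%E (@tuple_cons m)
  end.

End iid_sample.

Section missing_mass.
Context {R : realType}.

Definition missing_mass (p : probability Nplus R) (n : nat)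
    (X : n.-tuple Nplus) : R :=
  fine (\esum_(x in [set: Nplus]) (p [set x] * ((x \notin X)%:R)%:E)%E).

(* Only the values at n >= 1 are constrained; the value at n = 0 is junk. *)
Definition estimator (Mhat : forall n : nat, n.-tuple Nplus -> R) : Prop :=
  forall (n : nat) (X : n.-tuple Nplus), (0 < n)%N -> 0 <= Mhat n X <= 1.

(* The ratio f / M is undefined when the missing mass M is 0 (possible when p
   has finite support), whereas x / 0 = 0 here.  Samples with M = 0 never belong
   to rel_error_gt and always belong to rel_error_lt, so neither a large-error
   claim nor a failure of learning can come from an undefined ratio. *)
Definition rel_error_gt (p : probability Nplus R) (n : nat)
    (f : n.-tuple Nplus -> R) (eps : R) : set (n.-tuple Nplus) :=
  [set X | missing_mass p X != 0 /\
           eps < `|f X / missing_mass p X - 1|].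

Definition rel_error_lt (p : probability Nplus R) (n : nat)
    (f : n.-tuple Nplus -> R) (eps : R) : set (n.-tuple Nplus) :=
  [set X | missing_mass p X != 0 ->
           `|f X / missing_mass p X - 1| < eps].

Definition PAC_learns (Mhat : forall n : nat, n.-tuple Nplus -> R)
    (F : set (probability Nplus R)) : Prop :=
  forall p : probability Nplus R, F p ->
  forall eps delta : R, 0 < eps -> 0 < delta ->
  exists n0 : nat, forall n : nat, (n0 < n)%N ->
    ((1 - delta)%:E < iid_law p n (rel_error_lt p (Mhat n) eps))%E.

End missing_mass.

(* Main.v *)
(* Let p have tails T k = p{k+1, k+2, ...} with T 0 = 1 and, for k >= 1, T
   k equal to either w_k or 2 w_k, where w_k decreases so fast that a sample
   of size n_k satisfies n_k w_k = 1/16 and n_k w_(k-1) = 16 k. With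
   probability at least 3/4 such a sample shows each of the first k points
   and nothing else, so that the missing mass is exactly T k. The value of
   the estimator on such a sample cannot be within relative error 1/4 of both
   w_k and 2 w_k, hence one of the two choices of T k makes the estimator
   wrong with probability at least 3/8. The law of these samples is bounded
   below by weights that involve only T 0, ..., T (k-1), so the tails can be
   chosen one after the other, and the event at stage k does not depend on
   the later choices. *)
Require Import Defs.
From HB Require Import structures.
From mathcomp Require Import all_boot all_order all_algebra.
From mathcomp Require Import all_classical all_reals all_analysis.
From mathcomp Require Import ring lra zify.

Import Order.TTheory GRing.Theory Num.Theory.
Import numFieldNormedType.Exports.

Local Open Scope classical_set_scope.
Local Open Scope ring_scope.

(** * The law of a finite sample on the countable space of tuples *)

Lemma measurable_tuple_Nplus (n : nat) (A : set (n.-tuple Nplus)) :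
  measurable A.
Proof.
apply: countable_measurable => [X|]; last exact: countableP.
have -> : [set X] = \bigcap_(i in [set: 'I_n])
    ([set: n.-tuple Nplus] `&` (@tnth _ _)^~ i @^-1` [set tnth X i]).
  apply/seteqP; split => [_ -> i _//|Y h] /=.
  by apply: eq_from_tnth => i; case: (h i).
apply: fin_bigcap_measurable => // i _.
exact: measurable_tnth.
Qed.

Lemma iid_law_set1 (R : realType) (p : probability Nplus R) (n : nat)
    (X : n.-tuple Nplus) :
  iid_law p n [set X] = (\prod_(x <- X) p [set x])%E.
Proof.
elim: n X => [|n IHn] X.
  by rewrite (tuple0 X) big_tuple big_ord0 /= diracE mem_set.
case/tupleP: X => x X.
rewrite /= big_cons -IHn /distribution /pushforward /=.
rewrite (_ : _ @^-1` _ = [set x] `*` [set X]).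
  by rewrite product_measure1E//; exact: measurable_tuple_Nplus.
apply/seteqP; split => -[y Y] /=; last by move=> [-> ->]; apply: val_inj.
by move=> /(congr1 val)/= [-> e]; split => //; apply: val_inj.
Qed.

Definition mkN (j : nat) : Nplus := exist _ j.+1 isT.

Lemma mkN_inj : injective mkN.
Proof. by move=> i j []. Qed.

Lemma mkN_bij : set_bij [set: nat] [set: Nplus] mkN.
Proof.
split => // [i j _ _|[[//|j] h] _]; first exact: mkN_inj.
by exists j => //; apply: val_inj.
Qed.

(** [B] contains the disjoint singletons indexed by [S], and each has mass a product of point
    masses. Passing to lower bounds [r] gives an estimate that can be fixed before [p] is known. *)
Lemma iid_law_ge (R : realType) (p : probability Nplus R) (n k : nat)
    (r : 'I_k -> R) (S : pred {ffun 'I_n -> 'I_k}) (B : set (n.-tuple Nplus)) :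
  (forall j, 0 <= r j) -> (forall j : 'I_k, (r j)%:E <= p [set mkN j])%E ->
  (forall f, S f -> B [tuple mkN (f i) | i < n]) ->
  ((\sum_(f | S f) \prod_i r (f i))%:E <= iid_law p n B)%E.
Proof.
move=> r0 rp SB.
pose F (f : {ffun 'I_n -> 'I_k}) := [set [tuple mkN (f i) | i < n]].
apply: (@le_trans _ _ (iid_law p n (\bigcup_(f in [set` enum S]) F f))).
  rewrite measure_fin_bigcup //; last 2 first.
  - move=> f g _ _ [X [/= -> /(congr1 (fun t => tnth t))e]].
    apply/ffunP => i; move/(congr1 (fun t => t i)): e.
    by rewrite !tnth_mktuple => /mkN_inj/val_inj.
  - by move=> f _; exact: measurable_tuple_Nplus.
  rewrite -fsbig_seq ?enum_uniq// big_enum -sumEFin.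
  apply: lee_sum => f _.
  rewrite [leRHS]iid_law_set1 big_tuple -prodEFin.
  suff /andP[] : (0 <= \prod_i (r (f i))%:E <=
      \prod_i p [set tnth [tuple mkN (f i) | i < n] i])%E by [].
  elim/big_ind2 : _ => [|x1 x2 y1 y2 /andP[x0 xy] /andP[y0 xy']|i _].
  - by rewrite lee01 lexx.
  - by rewrite mule_ge0//= lee_pmul.
  - by rewrite lee_fin r0 tnth_mktuple rp.
apply: le_measure; rewrite ?inE; try exact: measurable_tuple_Nplus.
by move=> X [f /=]; rewrite mem_enum => Sf ->; exact: SB.
Qed.

(** * Distributions with prescribed tails *)

(** The sum telescopes. For [k = 0] it gives total mass 1; for general [k] it is the missing mass of
    a sample showing exactly the first [k] points. *)
Lemma tail_series (R : realType) (T : nat -> R) (k : nat) :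
  T @ \oo --> 0 ->
  (\sum_(0 <= j <oo) ((T j - T j.+1)%:E * ((k <= j)%N%:R)%:E) = (T k)%:E)%E.
Proof.
move=> T0; apply/cvg_lim => //.
have part n : (\sum_(0 <= j < n + k) ((T j - T j.+1)%:E * ((k <= j)%N%:R)%:E)
    = (T k - T (n + k)%N)%:E)%E.
  elim: n => [|n IHn].
    rewrite subrr big_nat big1// => j /andP[_]; rewrite add0n => jk.
    by rewrite leqNgt jk mule0.
  rewrite addSn big_nat_recr//= IHn leq_addl mule1 -EFinD.
  by congr EFin; lra.
rewrite -(cvg_shiftn k) [X in X @ _ --> _](funext part).
apply: cvg_EFin; first exact: nearW.
rewrite -[X in _ --> X]subr0.
apply: cvgB; first exact: cvg_cst.
by rewrite cvg_shiftn.
Qed.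

Lemma exists_tail_distribution (R : realType) (T : nat -> R) :
  T 0%N = 1 -> (forall j, T j.+1 <= T j) -> T @ \oo --> 0 ->
  exists p : probability Nplus R,
    forall j, p [set mkN j] = (T j - T j.+1)%:E.
Proof.
move=> T0 Td Tl.
have a0 j : 0 <= T j - T j.+1 by rewrite subr_ge0.
pose ms j : {measure set Nplus -> \bar R} :=
  mscale (NngNum (a0 j)) (dirac (mkN j)).
have mE A : mseries ms 0 A =
    (\sum_(0 <= j <oo) ((T j - T j.+1)%:E * \d_(mkN j) A))%E.
  by [].
have mT : mseries ms 0 setT = 1%E.
  rewrite mE -T0 -(tail_series _ _ 0%N Tl).
  by apply: eq_eseriesr => j _; rewrite diracT.
pose p : probability Nplus R :=
  HB.pack (mseries ms 0) (Measure_isProbability.Build _ _ _ (mseries ms 0) mT).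
exists p => j; rewrite [LHS]mE.
transitivity (\sum_(0 <= i <oo | i == j) (T i - T i.+1)%:E)%E.
  rewrite [RHS]eseries_mkcond; apply: eq_eseriesr => i _.
  rewrite diracE; case: eqVneq => [->|ij]; first by rewrite mem_set// mule1.
  by rewrite memNset ?mule0// => /mkN_inj/eqP; rewrite (negbTE ij).
rewrite nneseries_esum; last by move=> i _; rewrite lee_fin.
rewrite (_ : [set _ | _] = [set j]); first by rewrite esum_set1 ?lee_fin.
by apply/seteqP; split => i /= /eqP.
Qed.

Lemma missing_mass_tail (R : realType) (T : nat -> R) (p : probability Nplus R)
    (n k : nat) (X : n.-tuple Nplus) :
  T @ \oo --> 0 -> (forall j, p [set mkN j] = (T j - T j.+1)%:E) ->
  (forall j, (mkN j \in X) = (j < k)%N) -> missing_mass p X = T k.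
Proof.
move=> T0 pE XE; rewrite /missing_mass (reindex_esum _ _ _ _ mkN_bij).
rewrite -nneseries_esumT; last first.
  by move=> j; rewrite mule_ge0// ?lee_fin.
rewrite -[RHS]/(fine (T k)%:E) -(tail_series _ _ k T0); congr fine.
by apply: eq_eseriesr => j _; rewrite pE XE -leqNgt.
Qed.

(** * Recursive choice with memory of all earlier choices *)

Lemma greedy_choice (U : pointedType) (u : U) (good : nat -> U -> Prop)
    (Q : nat -> (nat -> U) -> U -> Prop) :
  good 0%N u ->
  (forall k T, (forall j, (j <= k)%N -> good j (T j)) ->
    exists t, good k.+1 t /\ Q k T t) ->
  (forall k T T' t, (forall j, (j <= k)%N -> T j = T' j) ->
    Q k T t -> Q k T' t) ->
  exists T, forall k, good k (T k) /\ Q k T (T k.+1).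
Proof.
move=> good0 step loc.
pose c k T := xget u [set t | good k.+1 t /\ Q k T t].
(* [g k] is a whole sequence whose values up to index [k] are final, so the diagonal [T] agrees with
   it there and locality carries [Q k] from [g k] to [T]. *)
pose g := fix g k : nat -> U :=
  if k is k'.+1 then fun j => if (j <= k')%N then g k' j else c k' (g k')
  else cst u.
pose T j := g j j.
have gT k j : (j <= k)%N -> g k j = T j.
  elim: k => [|k IHk]; first by rewrite leqn0 => /eqP ->.
  rewrite leq_eqVlt => /orP[/eqP ->//|]; rewrite ltnS => jk.
  by rewrite /= jk IHk.
have TS k : T k.+1 = c k (g k) by rewrite /T /= ltnn.
have cP k : (forall j, (j <= k)%N -> good j (T j)) ->
    good k.+1 (T k.+1) /\ Q k (g k) (T k.+1).
  move=> goodk; rewrite TS.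
  have /step[t ht] : forall j, (j <= k)%N -> good j (g k j).
    by move=> j jk; rewrite gT//; exact: goodk.
  exact: (@xgetPex _ u [set t | good k.+1 t /\ Q k (g k) t]) (ex_intro _ t ht).
have goodT k : forall j, (j <= k)%N -> good j (T j).
  elim: k => [|k IHk] j; first by rewrite leqn0 => /eqP ->.
  by rewrite leq_eqVlt => /orP[/eqP ->|/IHk//]; exact: (cP k IHk).1.
exists T => k; split; first exact: goodT (leqnn k).
by have [_] := cP k (goodT k); apply: loc => j; exact: gT.
Qed.

(** * Weight of the samples that show every point *)

Section occupancy.
Context {R : realType} {k n : nat}.
Implicit Type r : 'I_k -> R.

Definition occupied : pred {ffun 'I_n -> 'I_k} :=
  fun f => [forall j, exists i, f i == j].

(** Union bound: by distributivity the powers are sums over maps, and a map that is not onto misses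
    some [j]; the maps missing [j] weigh [(\sum_j r j - r j) ^+ n]. *)
Lemma occupied_mass_ge r : (forall j, 0 <= r j) ->
  (\sum_j r j) ^+ n - \sum_j (\sum_j r j - r j) ^+ n <=
  \sum_(f | occupied f) \prod_i r (f i).
Proof.
move=> r0.
have -> : (\sum_j r j) ^+ n = \sum_(f : {ffun 'I_n -> 'I_k}) \prod_i r (f i).
  by rewrite -(bigA_distr_bigA (fun _ => r)) prodr_const card_ord.
rewrite (bigID occupied)/= lerBlDr lerD2l.
have -> : \sum_j (\sum_j r j - r j) ^+ n =
    \sum_j \sum_(f : {ffun 'I_n -> 'I_k} | [forall i, f i != j])
      \prod_i r (f i).
  apply: eq_bigr => j _.
  rewrite (bigD1 j)//= [_ + _ - _]addrC addKr.
  transitivity (\prod_(i < n) \sum_(l | l != j) r l).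
    by rewrite prodr_const card_ord.
  by rewrite (bigA_distr_big (predC1 j) (fun _ => r)).
rewrite (exchange_big_dep predT)//=.
rewrite big_mkcond/=; apply: ler_sum => f _.
have P0 : 0 <= \prod_i r (f i) by exact: prodr_ge0.
case: ifP => [/forallPn[j /existsPn fj]|_]; last exact: sumr_ge0.
rewrite (bigD1 j)/=; last exact/forallP.
by rewrite lerDl sumr_ge0.
Qed.

End occupancy.

(** * Elementary bounds for powers of 1 - x *)

Lemma bernoulli_1B (R : realFieldType) (x : R) (n : nat) : 0 <= x <= 1 ->
  1 - n%:R * x <= (1 - x) ^+ n.
Proof.
move=> /andP[x0 x1]; elim: n => [|n IHn]; first by rewrite mul0r subr0 expr0.
rewrite exprS -natr1.
have : 0 <= n%:R * x * x by rewrite !mulr_ge0.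
have : (1 - x) * (1 - n%:R * x) <= (1 - x) * (1 - x) ^+ n.
  by rewrite ler_wpM2l// subr_ge0.
lra.
Qed.

(** An algebraic substitute for (1 - x)^n <= exp(-nx), by induction from (1 - x)(1 + (n+1)x) <= 1 +
    nx. *)
Lemma expr_1B_le (R : realFieldType) (x : R) (n : nat) : 0 <= x <= 1 ->
  (1 - x) ^+ n * (1 + n%:R * x) <= 1.
Proof.
move=> /andP[x0 x1]; elim: n => [|n IHn].
  by rewrite mul0r addr0 expr0 mulr1.
apply: le_trans IHn; rewrite exprSr -mulrA ler_wpM2l//.
  by rewrite exprn_ge0// subr_ge0.
rewrite -natr1.
have : 0 <= n%:R * x * x by rewrite !mulr_ge0.
have : 0 <= x * x by rewrite mulr_ge0.
lra.
Qed.

(** * Scales and sample sizes *)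

(** The inverse of w_k. The ratio 256 k is forced by n_k w_k = 1/16 and n_k w_(k-1) = 16 k. *)
Fixpoint scale (k : nat) : nat :=
  if k is k'.+1 then (256 * k * scale k')%N else 1%N.

Definition sample_size (k : nat) : nat := (16 * k * scale k.-1)%N.

Lemma scale_gt0 k : (0 < scale k)%N.
Proof. by elim: k => // k IHk; rewrite /= !muln_gt0. Qed.

Lemma scaleS k : scale k.+1 = (256 * k.+1 * scale k)%N.
Proof. by []. Qed.

Lemma sample_size_gt0 k : (0 < k)%N -> (0 < sample_size k)%N.
Proof. by move=> k0; rewrite !muln_gt0 k0 scale_gt0. Qed.

Lemma sample_size_ltn j k : (0 < j)%N -> (j < k)%N ->
  (sample_size j < sample_size k)%N.
Proof.
move=> j0; elim: k => // k IHk; rewrite ltnS leq_eqVlt => jk.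
apply: (@leq_ltn_trans (sample_size k)).
  by case/orP: jk => [/eqP ->//|/IHk/ltnW].
case: k {IHk} jk => [|k] jk; first by move: jk; rewrite ltn0 orbF; lia.
by rewrite /sample_size /=; have := scale_gt0 k; nia.
Qed.

(** * One stage: choosing the next tail against the estimator *)

Section greedy_step.
Context {R : realType}.
Implicit Types (T : nat -> R) (k : nat).

Definition width k : R := (scale k)%:R^-1.

Lemma width_gt0 k : 0 < width k.
Proof. by rewrite invr_gt0 ltr0n scale_gt0. Qed.

Lemma scale_neq0 k : (scale k)%:R != 0 :> R.
Proof. by rewrite pnatr_eq0 -lt0n scale_gt0. Qed.

Lemma widthS k : width k = 256 * k.+1%:R * width k.+1.
Proof.
rewrite /width scaleS !natrM invfM.
have k0 : k.+1%:R != 0 :> R by rewrite pnatr_eq0.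
move: (scale_neq0 k) k0; move: (scale k)%:R (k.+1%:R) => a b a0 b0.
by field; rewrite a0 b0.
Qed.

Lemma width_sample k : 16 * (sample_size k.+1)%:R * width k.+1 = 1.
Proof.
rewrite /width /sample_size scaleS !natrM /=.
have k0 : k.+1%:R != 0 :> R by rewrite pnatr_eq0.
move: (scale_neq0 k) k0; move: (scale k)%:R (k.+1%:R) => a b a0 b0.
by field; rewrite a0 b0.
Qed.

Lemma widthS_le k : 4 * width k.+1 <= width k.
Proof.
rewrite [leRHS]widthS ler_wpM2r ?(ltW (width_gt0 _))//.
by rewrite -natrM ler_nat; lia.
Qed.

Lemma width_le k j : (j <= k)%N -> width k <= width j.
Proof.
elim: k => [|k IHk]; first by rewrite leqn0 => /eqP ->.
rewrite leq_eqVlt => /orP[/eqP ->//|]; rewrite ltnS => /IHk; apply: le_trans.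
by have := widthS_le k; have := width_gt0 k.+1; lra.
Qed.

Lemma width_cvg0 : width @ \oo --> 0.
Proof.
apply: (@squeeze_cvgr _ _ _ _ (cst 0) harmonic); last 2 first.
- exact: cvg_cst.
- exact: cvg_harmonic.
apply: nearW => k; rewrite (ltW (width_gt0 k))/= /width lef_pV2 ?posrE ?ltr0n//.
  rewrite ler_nat.
  elim: k => // k IHk; rewrite scaleS; nia.
exact: scale_gt0.
Qed.

(** The estimates need only the interval spanned by the two candidate tails; at [k = 0] the tail is
    the total mass. *)
Definition admissible k (t : R) :=
  (k = 0%N -> t = 1) /\ width k <= t <= 2 * width k.

(* Lower bounds, valid for every admissible choice of [T k.+1], on the masses
   of the first [k.+1] atoms. *)
Definition atom_lb T k (j : 'I_k.+1) : R :=
  T j - (if j == k :> nat then 2 * width k.+1 else T j.+1).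

(** Samples showing exactly the first [k.+1] points, coded as surjections. Their missing mass will
    be [T k.+1], for which [t] is a candidate. *)
Definition bad_samples k (f : (sample_size k.+1).-tuple Nplus -> R) (t : R) :
    pred {ffun 'I_(sample_size k.+1) -> 'I_k.+1} :=
  fun X => occupied X &&
    (1/4 < `|f [tuple mkN (X i) | i < sample_size k.+1] / t - 1|).

(** Widths drop at least fourfold, so w_j - 2 w_(j+1) >= w_j / 2 >= w_k / 2. *)
Lemma atom_lb_ge T k (j : 'I_k.+1) :
  (forall i, (i <= k)%N -> admissible i (T i)) -> width k / 2 <= atom_lb T k j.
Proof.
move=> goodT; rewrite /atom_lb.
have jk : (j <= k)%N by rewrite -ltnS.
have [_ /andP[Tj _]] := goodT j jk.
have := width_le _ _ jk; have := widthS_le j.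
case: eqVneq => [e|jk'].
  by move: Tj; rewrite e; have := width_gt0 k; lra.
have /goodT[_ /andP[_]] : (j.+1 <= k)%N by rewrite ltn_neqAle jk'.
by move: Tj; lra.
Qed.

Lemma sum_atom_lb T k : (forall i, (i <= k)%N -> admissible i (T i)) ->
  \sum_j atom_lb T k j = 1 - 2 * width k.+1.
Proof.
move=> goodT; rewrite big_ord_recr/= /atom_lb eqxx.
have -> : 1 = T 0%N by have [->] := goodT 0%N (leq0n k).
under eq_bigr => i _ do rewrite /= ltn_eqF//.
rewrite -(big_mkord xpredT (fun i => T i - T i.+1)).
have := telescope_sumr T (leq0n k).
under eq_bigr do rewrite -opprB.
rewrite sumrN; lra.
Qed.

(** All draws fall among the first [k.+1] points with weight at least 1 - 2 n w_(k+1) = 7/8, and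
    missing one of these points costs at most 1/8 in total. *)
Lemma occupied_atom_lb T k : (forall i, (i <= k)%N -> admissible i (T i)) ->
  3/4 <= \sum_(X : {ffun 'I_(sample_size k.+1) -> 'I_k.+1} | occupied X)
           \prod_i atom_lb T k (X i).
Proof.
move=> goodT.
have lb := fun j => atom_lb_ge T k j goodT.
have w0 := width_gt0 k; have w1 := width_gt0 k.+1.
apply: le_trans (occupied_mass_ge _ _); last first.
  by move=> j; apply: le_trans (lb j); lra.
set n := sample_size k.+1.
have nw : 16 * n%:R * width k.+1 = 1 by exact: width_sample.
have w1' : width k <= 1.
  by rewrite (le_trans (width_le _ _ (leq0n k)))// /width invr1.
have w2 := widthS_le k.
rewrite sum_atom_lb//.
have h1 : 7/8 <= (1 - 2 * width k.+1) ^+ n.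
  have x01 : 0 <= 2 * width k.+1 <= 1 by apply/andP; split; lra.
  by apply: le_trans (bernoulli_1B _ _ n x01); lra.
have h2 j : (1 - 2 * width k.+1 - atom_lb T k j) ^+ n <= (8 * k.+1%:R)^-1.
  apply: (@le_trans _ _ ((1 - width k / 2) ^+ n)).
    apply: lerXn2r; rewrite ?nnegrE; last first.
    - by have := lb j; lra.
    - by lra.
    - rewrite -(sum_atom_lb T)// (bigD1 j)//= [_ + _ - _]addrC addKr.
      by apply: sumr_ge0 => i _; apply: le_trans (lb i); lra.
  have k0 : (0 : R) < k.+1%:R by rewrite ltr0n.
  rewrite -[leRHS]div1r ler_pdivlMr; last by rewrite mulr_gt0.
  have x01 : 0 <= width k / 2 <= 1 by apply/andP; split; lra.
  apply: le_trans (expr_1B_le _ _ n x01).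
  apply: ler_wpM2l; first by rewrite exprn_ge0//; lra.
  (* Multiplied by [16 * k.+1], [nw] says n w_k = 16 (k+1), hence n x = 8 (k+1) for x = w_k / 2. *)
  have := widthS k; move: nw => /(congr1 (fun x => x * 16 * k.+1%:R)); nra.
have : \sum_j (1 - 2 * width k.+1 - atom_lb T k j) ^+ n <= 1/8.
  apply: le_trans (ler_sum _ (fun j _ => h2 j)) _.
  rewrite sumr_const card_ord -[_ *+ _]mulr_natr invfM -mulrA mulVf ?pnatr_eq0//.
  by lra.
by move: h1; lra.
Qed.

Lemma exists_bad_tail T k (f : (sample_size k.+1).-tuple Nplus -> R) :
  (forall i, (i <= k)%N -> admissible i (T i)) ->
  exists t, admissible k.+1 t /\
    1/4 < \sum_(X | bad_samples k f t X) \prod_i atom_lb T k (X i).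
Proof.
move=> goodT; have w1 := width_gt0 k.+1.
have lb (X : {ffun 'I_(sample_size k.+1) -> 'I_k.+1}) :
    0 <= \prod_i atom_lb T k (X i).
  apply: prodr_ge0 => i _; apply: le_trans (atom_lb_ge _ _ _ goodT).
  by have := width_gt0 k; lra.
have split X : occupied X ->
    bad_samples k f (width k.+1) X || bad_samples k f (2 * width k.+1) X.
  move=> oX; rewrite /bad_samples oX /=.
  set y := f _.
  have -> : y / (2 * width k.+1) = y / width k.+1 / 2.
    by rewrite invfM mulrA mulrAC.
  set z := y / _.
  (* Two small errors would force both z <= 5/4 and z >= 3/2. *)
  rewrite !real_ltNge ?num_real// -negb_and; apply/negP => /andP[].
  by rewrite !ler_norml => /andP[? ?] /andP[? ?]; lra.
have [lt1|ge1] := ltP (1/4)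
    (\sum_(X | bad_samples k f (width k.+1) X) \prod_i atom_lb T k (X i)).
  by exists (width k.+1); split => //; split => //; apply/andP; split; lra.
exists (2 * width k.+1); split; first by split => //; apply/andP; split; lra.
rewrite ltNge; apply/negP => ge2.
have := occupied_atom_lb T k goodT; apply/negP; rewrite -ltNge.
(* If both candidates had bad weight at most 1/4, the occupied samples would weigh at most 1/2 <
   3/4. *)
apply: (@le_lt_trans _ _ (1/4 + 1/4)); last by lra.
apply: le_trans (lerD ge1 ge2).
rewrite big_mkcond [X in _ <= X + _]big_mkcond [X in _ <= _ + X]big_mkcond.
rewrite -big_split/=; apply: ler_sum => X _.
case: ifP => [/split|_]; last by rewrite addr_ge0//; case: ifP.
have := lb X.
by case: bad_samples; case: bad_samples => //=; lra.
Qed.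

End greedy_step.

(** * Assembly of the stages and the conclusion *)

Lemma exists_bad_distribution (R : realType)
    (Mhat : forall n : nat, n.-tuple Nplus -> R) :
  exists p : probability Nplus R, forall k, (1 <= k)%N ->
    ((1/4)%:E < iid_law p (sample_size k)
       (rel_error_gt p (Mhat (sample_size k)) (1/4)))%E.
Proof.
pose Q k (T : nat -> R) t := 1/4 <
  \sum_(X | bad_samples k (Mhat (sample_size k.+1)) t X)
    \prod_i atom_lb T k (X i).
have [|k T|k T T' t TT'|T goodQ] := @greedy_choice R 1 admissible Q.
- by split => //; rewrite /width invr1; apply/andP; split; lra.
- exact: exists_bad_tail.
(* Locality: [atom_lb T k] reads [T j.+1] only for j < k, the last atom using [2 * width k.+1]
   instead. *)
- rewrite /Q; under eq_bigr => X _.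
    under eq_bigr => i _.
      have -> : atom_lb T k (X i) = atom_lb T' k (X i).
        rewrite /atom_lb TT' -1?ltnS//; case: eqVneq => // ik.
        by rewrite TT'// ltn_neqAle ik -ltnS/=.
      over.
    over.
  by [].
have goodT j : admissible j (T j) := (goodQ j).1.
have T0 : T 0%N = 1 by have [->] := goodT 0%N.
have Td j : T j.+1 <= T j.
  have [_ /andP[? ?]] := goodT j; have [_ /andP[? ?]] := goodT j.+1.
  by have := widthS_le (R := R) j; have := width_gt0 (R := R) j.+1; lra.
have Tl : T @ \oo --> 0.
  apply: (@squeeze_cvgr _ _ _ _ (cst 0) (fun k => 2 * width k)).
  - apply: nearW => k; have [_ /andP[? ?]] := goodT k.
    by have := width_gt0 (R := R) k; move=> ?; apply/andP; split => /=; lra.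
  - exact: cvg_cst.
  - by rewrite -[X in _ --> X](mulr0 2); apply: cvgM;
      [exact: cvg_cst|exact: width_cvg0].
have [p pE] := exists_tail_distribution _ _ T0 Td Tl.
exists p => -[//|k] _.
have [_] := goodQ k; rewrite /Q -lte_fin => /lt_le_trans; apply.
apply: iid_law_ge => [j|j|X /andP[/forallP oX eX]].
- apply: le_trans (atom_lb_ge _ _ _ _) => //.
  by have := width_gt0 (R := R) k; lra.
- rewrite pE lee_fin /atom_lb; case: eqVneq => // ->.
  by have [_ /andP[? ?]] := goodT k.+1; lra.
- have ME : missing_mass p [tuple mkN (X i) | i < sample_size k.+1] = T k.+1.
    apply: (missing_mass_tail _ _ _ _ _ _ Tl pE) => j.
    apply/idP/idP => [/mapP[i _ /mkN_inj ->]|jk]; first exact: ltn_ord.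
    have /existsP[i /eqP Xi] := oX (Ordinal jk).
    by apply/mapP; exists i; rewrite ?mem_enum// Xi.
  rewrite /rel_error_gt /= ME; split => //.
  have [_ /andP[? _]] := goodT k.+1.
  by have := width_gt0 (R := R) k.+1; move=> ?; apply/eqP; lra.
Qed.

Theorem theorem2 (R : realType) :
  (exists (eps : R) (N : nat -> nat),
    [/\ 0 < eps,
        (forall k : nat, (1 <= k)%N -> (0 < N k)%N),
        (forall j k : nat, (1 <= j)%N -> (j < k)%N -> (N j < N k)%N) &
        forall Mhat : (forall n : nat, n.-tuple Nplus -> R), estimator Mhat ->
        exists pstar : probability Nplus R,
        forall k : nat, (1 <= k)%N ->
          (eps%:E < iid_law pstar (N k) (rel_error_gt pstar (Mhat (N k)) eps))%E])
  /\
  (forall Mhat : (forall n : nat, n.-tuple Nplus -> R), estimator Mhat ->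
    ~ PAC_learns Mhat [set: probability Nplus R]).
Proof.
split.
  exists (1/4), sample_size; split => [|||Mhat _].
  - by lra.
  - exact: sample_size_gt0.
  - exact: sample_size_ltn.
  - exact: exists_bad_distribution.
move=> Mhat _ learns.
have [p bad] := exists_bad_distribution R Mhat.
have q0 : (0 : R) < 1/4 by lra.
have [n0 good_n] := learns p I _ _ q0 q0.
have nN : (n0 < sample_size n0.+1)%N.
  by rewrite /sample_size; have := scale_gt0 n0.+1.-1; nia.
(* With both parameters equal to 1/4, the disjoint success and failure events have masses above 3/4
   and 1/4, which exceeds 1 in total. *)
have := lteD (good_n _ nN) (bad n0.+1 isT).
rewrite -EFinD subrK -measureU; last 3 first.
- exact: measurable_tuple_Nplus.
- exact: measurable_tuple_Nplus.
- apply/seteqP; split => // X [/= lt [M0 gt]].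
  by have := lt_trans gt (lt M0); rewrite ltxx.
by rewrite ltNge probability_le1//; exact: measurable_tuple_Nplus.
Qed.
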